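(* Let $d\ge 3$, $p=\frac{2d}{d-2}$ and $\beta>\frac p2$. There is a constant $C=C(d,\beta)<\infty$ such that the following holds. Suppose $\omega\in\Omega$ is such that $\mathcal{M}(\nu^\omega+1)(x)<\infty$ for all $x\in\mathbb{Z}^d$, and denote $m_\beta^\omega(x):=[\mathcal{M}(\nu^\omega+1)(x)]^{-\beta}$. Then $$\Big(\sum_{x\in\mathbb{Z}^d} m_\beta^\omega(x)\,|f(x)|^p\Big)^{2/p}\le C\,\mathcal{E}^\omega(f,f)$$ for all finitely supported $f:\mathbb{Z}^d\to\mathbb{R}$.
   Context: $x\sim y$ means that $x,y\in\mathbb{Z}^d$ are nearest neighbors ($|x-y|=1$). $\Omega=(0,\infty)^{E_d}$, where $E_d$ is the set of unoriented nearest-neighbor edges of $\mathbb{Z}^d$; for $\omega\in\Omega$, $\omega(x,y)=\omega(y,x)>0$ is the conductance of the edge $\{x,y\}$, and $\omega(x,y)=0$ if $x\not\sim y$. Set $\nu^\omega(x):=\sum_{y\sim x}\omega(x,y)^{-1}$. The Dirichlet form is $$\mathcal{E}^\omega(f,g)=\tfrac12\sum_x\sum_{y\sim x}\omega(x,y)[f(y)-f(x)][g(y)-g(x)].$$ For $h:\mathbb{Z}^d\to[0,\infty)$ the Hardy–Littlewood maximal function is $(\mathcal{M}h)(x)=\sup_{Q\ni x}\frac1{|Q|}\sum_{y\in Q}h(y)\in[0,\infty]$, where the supremum is over all lattice cubes $Q=z+Q_R$ containing $x$, with $z\in\mathbb{Z}^d$, $R\ge0$, $Q_R=[-R,R]^d\cap\mathbb{Z}^d$.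 *)

(* Defs.v *)
From HB Require Import structures.
From mathcomp Require Import all_boot all_order all_algebra finmap.
From mathcomp Require Import all_classical all_reals all_analysis.

Set Implicit Arguments.
Unset Strict Implicit.
Unset Printing Implicit Defensive.

Import Order.TTheory GRing.Theory Num.Theory.

Local Open Scope classical_set_scope.
Local Open Scope ring_scope.

Notation lattice d := 'rV[int]_d.

(* On integer vectors the l1 norm equals 1 iff the Euclidean norm does. *)
Definition nbr (d : nat) (x y : lattice d) : bool :=
  \sum_(i < d) `|x 0 i - y 0 i| == 1.

Definition nbrs (d : nat) (x : lattice d) : set (lattice d) :=
  [set y | nbr x y].

(* An element of (0, oo)^{E_d}, seen as a symmetric function of the two
   endpoints that is extended by 0 to the non-neighboring pairs. *)
Definition conductance (R : realType) (d : nat)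
    (w : lattice d -> lattice d -> R) : Prop :=
  [/\ forall x y, w x y = w y x,
      forall x y, nbr x y -> 0 < w x y &
      forall x y, ~~ nbr x y -> w x y = 0].

Definition nu (R : realType) (d : nat) (w : lattice d -> lattice d -> R)
    (x : lattice d) : R :=
  \sum_(y \in nbrs x) (w x y)^-1.

(* The sum over x is a sum over the support of the summand, which is finite as
   soon as f or g is finitely supported; it is meant only for such f, g. *)
Definition dirichlet (R : realType) (d : nat)
    (w : lattice d -> lattice d -> R) (f g : lattice d -> R) : R :=
  2^-1 * \sum_(x \in [set: lattice d]) \sum_(y \in nbrs x)
    w x y * (f y - f x) * (g y - g x).

(* z + [-r, r]^d, for a real r. *)
Definition cube (R : realType) (d : nat) (z : lattice d) (r : R) :
    set (lattice d) :=
  [set y | forall i : 'I_d, `|(y 0 i - z 0 i)%:~R| <= r].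

Definition average (R : realType) (d : nat) (Q : set (lattice d))
    (h : lattice d -> R) : R :=
  (#|` fset_set Q|%fset%:R)^-1 * \sum_(y \in Q) h y.

(* Hardy-Littlewood maximal function. *)
Definition maximal (R : realType) (d : nat) (h : lattice d -> R)
    (x : lattice d) : \bar R :=
  ereal_sup [set a | exists (z : lattice d) (r : R),
    [/\ 0 <= r, cube z r x & a = (average (cube z r) h)%:E]].

(* fine loses nothing where the maximal function is finite. *)
Definition weight (R : realType) (d : nat) (beta : R)
    (w : lattice d -> lattice d -> R) (x : lattice d) : R :=
  fine (maximal (fun y => nu w y + 1) x) `^ (- beta).

(* Main.v *)
Require Import Defs.
From HB Require Import structures.
From mathcomp Require Import all_boot all_order all_algebra finmap.
From mathcomp Require Import all_classical all_reals all_analysis.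
From mathcomp Require Import ring lra zify.

Set Implicit Arguments.
Unset Strict Implicit.
Unset Printing Implicit Defensive.

Import Order.TTheory GRing.Theory Num.Theory.

Local Open Scope classical_set_scope.
Local Open Scope ring_scope.

(** Write g for the maximal function of nu + 1, q = p/2 = d/(d-2), and let D be
twice the Dirichlet form of f, that is D = sum_y G(y) with
G(y) = sum_(z ~ y) w(y,z) (f(z) - f(y))^2. Everything rests on a weak-type
estimate without weights ([weak_estimate]): if A is a set of n points on which
f >= lam and g <= g0, then n <= (C g0 D / lam^2)^q.

To prove it, let P_k f(x) be the mean of f over the box of side 4^k with lowest
corner x. Since f has finite support, P_k f tends to 0, so that f on A is
essentially the sum of the increments P_k f - P_(k+1) f. By an L1 Poincare
inequality on the box of side N = 4^(k+1) ([box_avg_diff]) such an increment is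
at most a constant times N^(1-d) times the sum of |grad f| over that box, and
|grad f|^2 <= G nu pointwise ([gradient_le_energy]). Summing over x in A and
using the Cauchy-Schwarz inequality over the pairs (x, y) with x in A and y in
the box of x leaves two factors. The sum of nu is at most n (3N)^d g0, by
definition of the maximal function. The sum of G is at most min(n, N^d) D,
since for fixed x the points y are distinct, and so they are for a fixed
displacement y - x ([sum_box_translates]). The k-th term is therefore at most
(a constant times) sqrt(D g0 n) N^(1-d/2) min(n, N^d)^(1/2), which decays
geometrically on both sides of the scale N ~ n^(1/d) because d >= 3. Altogether
n lam <= C sqrt(D g0 n) n^(1/d), which is the claim.

The weighted inequality follows by cutting in two ways
([weighted_sobolev_seq]). The slices f_k of |f| between the levels c 2^k and
c 2^(k+1) have Dirichlet forms that add up to at most that of f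
([sum_dirichlet_slice]); applying the weak estimate to f_k at the level c 2^k
turns the weak bound into a strong one (truncation), because
sum_k D(f_k)^q <= (sum_k D(f_k))^q for q >= 1. Cutting the space into the layers
where g lies between 2^j and 2^(j+1) costs 2^(jq) in the weak estimate and
gains 2^(-j beta) from the weight, and sum_j 2^(j (q - beta)) converges since
beta > q. *)

(** * Cauchy-Schwarz and the Poincare inequality on a finite grid *)

(** The Cauchy-Schwarz inequality, in the form that avoids square roots of the
two factors: [h] is only dominated by the geometric mean of [a] and [b]. *)
Lemma sum_sqr_le_prod (R : realFieldType) (I : Type) (s : seq I) (h a b : I -> R) :
  (forall i, 0 <= h i) -> (forall i, 0 <= a i) -> (forall i, 0 <= b i) ->
  (forall i, h i ^+ 2 <= a i * b i) ->
  (\sum_(i <- s) h i) ^+ 2 <= (\sum_(i <- s) a i) * (\sum_(i <- s) b i).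
Proof.
move=> h0 a0 b0 hab; elim: s => [|i s IH]; first by rewrite !big_nil expr0n mul0r.
rewrite !big_cons.
have := hab i; have := h0 i; have := a0 i; have := b0 i.
have : 0 <= \sum_(i <- s) h i by apply: sumr_ge0.
have : 0 <= \sum_(i <- s) a i by apply: sumr_ge0.
have : 0 <= \sum_(i <- s) b i by apply: sumr_ge0.
move: IH.
move: (\sum_(i <- s) h i) (\sum_(i <- s) a i) (\sum_(i <- s) b i) (h i) (a i) (b i).
move=> S X Y h' a' b' SXY Y0 X0 S0 b'0 a'0 h'0 hab'.
have cross : 2 * (S * h') <= X * b' + Y * a'.
  rewrite -(@ler_pXn2r _ 2) ?nnegrE ?addr_ge0 ?mulr_ge0//.
  have : (S * h') ^+ 2 <= (X * Y) * (a' * b').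
    by rewrite exprMn; apply: ler_pM => //; exact: sqr_ge0.
  have := sqr_ge0 (X * b' - Y * a').
  rewrite !expr2; lra.
rewrite !expr2 in SXY hab' *; nra.
Qed.

Definition set_coord (I : finType) (T : Type) (u : {ffun I -> T}) (i : I) (t : T) :=
  [ffun j => if j == i then t else u j].

(** The stages of a lattice path from [u] to [v] that adjusts one coordinate
after the other. *)
Definition splice d (T : Type) (j : nat) (u v : {ffun 'I_d -> T}) : {ffun 'I_d -> T} :=
  [ffun i : 'I_d => if (i < j)%N then v i else u i].

(** Exchanging the new value with the overwritten one is an involution of the
pairs (point, value), so no grid point is favoured by the update. *)
Lemma sum_set_coord (R : realFieldType) (I T : finType) (i : I)
    (H : {ffun I -> T} -> R) :
  \sum_u \sum_t H (set_coord u i t) = #|T|%:R * \sum_u H u.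
Proof.
rewrite pair_bigA /=.
pose swap (q : {ffun I -> T} * T) := (set_coord q.1 i q.2, q.1 i).
have swapK : involutive swap.
  case=> u t; rewrite /swap /=; congr pair; last by rewrite ffunE eqxx.
  by apply/ffunP => j; rewrite !ffunE; case: eqP => // ->.
rewrite (reindex_inj (inv_inj swapK)) /=.
rewrite (eq_bigr (fun q => H q.1)); last first.
  move=> [u t] _ /=; congr H; apply/ffunP => j; rewrite !ffunE.
  by case: eqP => // ->.
rewrite -(pair_bigA _ (fun u t => H u)) /= mulr_sumr; apply: eq_bigr => u _.
by rewrite sumr_const mulr_natl.
Qed.

(** L1 Poincare inequality on the grid [T]^d. Join [u] to [v] by adjusting one
coordinate at a time. Exchanging the first [j] coordinates of [u] and [v] is an
involution of the set of pairs, so the [j]-th stage of the path is equidistributed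
when ([u], [v]) ranges over all pairs, and the line through it in direction [j]
meets every grid point equally often. *)
Lemma grid_poincare (R : realFieldType) d (T : finType)
    (F H : {ffun 'I_d -> T} -> R) :
  (forall u i t, `|F u - F (set_coord u i t)| <= \sum_s H (set_coord u i s)) ->
  \sum_u \sum_v `|F u - F v| <= (d * #|T| ^ d.+1)%:R * \sum_u H u.
Proof.
move=> FH.
have path u v : `|F u - F v| <= \sum_(j < d) \sum_s H (set_coord (splice j u v) j s).
  have -> : F u - F v = - \sum_(0 <= j < d) (F (splice j.+1 u v) - F (splice j u v)).
    rewrite telescope_sumr // opprB; congr (F _ - F _); apply/ffunP => i.
      by rewrite ffunE ltn0.
    by rewrite ffunE ltn_ord.
  rewrite normrN big_mkord; apply: le_trans (ler_norm_sum _ _ _) _.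
  apply: ler_sum => j _; rewrite distrC.
  suff -> : splice j.+1 u v = set_coord (splice j u v) j (v j) by [].
  apply/ffunP => i; rewrite !ffunE ltnS leq_eqVlt -val_eqE /=.
  by case: eqVneq => //= /ord_inj ->.
apply: (@le_trans _ _ (\sum_u \sum_v \sum_(j < d) \sum_s H (set_coord (splice j u v) j s))).
  by apply: ler_sum => u _; apply: ler_sum => v _.
rewrite pair_bigA exchange_big /=.
rewrite (eq_bigr (fun=> (#|T| ^ d.+1)%:R * \sum_u H u)); last first.
  move=> j _.
  (* The swap turns the j-th stage of the path into the first point of the pair. *)
  pose swap (q : {ffun 'I_d -> T} * {ffun 'I_d -> T}) :=
    (splice j q.1 q.2, splice j q.2 q.1).
  have swapK : involutive swap.
    by case=> u v; rewrite /swap /=; congr pair; apply/ffunP => i; rewrite !ffunE;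
      case: (i < j)%N.
  rewrite (reindex_inj (inv_inj swapK)) /=.
  rewrite (eq_bigr (fun q => \sum_s H (set_coord q.1 j s))); last first.
    move=> [u v] _ /=; apply: eq_bigr => s _; congr (H (set_coord _ _ _)).
    by apply/ffunP => i; rewrite !ffunE; case: (i < j)%N.
  rewrite -(pair_bigA _ (fun u _ => \sum_s H (set_coord u j s))) /=.
  rewrite (eq_bigr (fun u => (#|T| ^ d)%:R * \sum_s H (set_coord u j s))); last first.
    by move=> u _; rewrite sumr_const card_ffun card_ord mulr_natl.
  by rewrite -mulr_sumr sum_set_coord mulrA -natrM expnSr.
by rewrite sumr_const card_ord natrM -mulrA (mulr_natl _ d).
Qed.

(** * Means over boxes of the lattice *)

(** Removing one occurrence of each entry of [s1] from [s2] leaves a nonnegative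
remainder. *)
Lemma ler_sum_sub (R : realFieldType) (T : eqType) (s1 s2 : seq T) (F : T -> R) :
  uniq s1 -> {subset s1 <= s2} -> (forall x, 0 <= F x) ->
  \sum_(x <- s1) F x <= \sum_(x <- s2) F x.
Proof.
move=> + + F0; elim: s1 s2 => [|x s1 IH] s2 /=.
  by move=> _ _; rewrite big_nil sumr_ge0.
move=> /andP[xs1 us1] sub.
have xs2 : x \in s2 by apply: sub; rewrite mem_head.
rewrite big_cons (perm_big _ (perm_to_rem xs2)) big_cons lerD2l.
apply: IH => // y ys1; have := sub y; rewrite inE ys1 orbT => /(_ isT).
rewrite (perm_mem (perm_to_rem xs2)) inE => /orP[/eqP yx|//].
by rewrite -yx ys1 in xs1.
Qed.

Definition box_point d N (x : lattice d) (u : {ffun 'I_d -> 'I_N}) : lattice d :=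
  \row_i (x 0 i + (nat_of_ord (u i))%:Z).

Lemma box_point_injr d N (x : lattice d) : injective (@box_point d N x).
Proof.
move=> u v /rowP uv; apply/ffunP => i; have := uv i; rewrite !mxE => /addrI [].
by move/ord_inj.
Qed.

Lemma box_point_injl d N (u : {ffun 'I_d -> 'I_N}) : injective (fun x => box_point x u).
Proof. by move=> x y /rowP xy; apply/rowP => i; have := xy i; rewrite !mxE => /addIr. Qed.

Definition box d N (x : lattice d) : seq (lattice d) :=
  [seq box_point x u | u <- enum {: {ffun 'I_d -> 'I_N}}].

Lemma box_uniq d N (x : lattice d) : uniq (box N x).
Proof. by rewrite map_inj_uniq ?enum_uniq//; exact: box_point_injr. Qed.

Lemma mem_box d N (x y : lattice d) :
  (y \in box N x) = [forall i, (0 <= y 0 i - x 0 i) && (y 0 i - x 0 i < N%:Z)].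
Proof.
apply/mapP/forallP => [[u _ ->] i|yx].
  rewrite mxE; have := ltn_ord (u i); move: (nat_of_ord (u i)) (x 0 i) => n z ?.
  by rewrite addrAC subrr add0r; apply/andP; split; lia.
have h (i : 'I_d) : (absz (y ord0 i - x ord0 i)%R < N)%N.
  by have := yx i; move: (y 0 i - x 0 i) => z; lia.
exists [ffun i => Ordinal (h i)]; first by rewrite mem_enum.
by apply/rowP => i; rewrite mxE ffunE /=; have := yx i; move: (y 0 i) (x 0 i) => a b; lia.
Qed.

Lemma big_box (R : realFieldType) d N (x : lattice d) (F : lattice d -> R) :
  \sum_(y <- box N x) F y = \sum_(u : {ffun 'I_d -> 'I_N}) F (box_point x u).
Proof. by rewrite big_map big_enum. Qed.

Lemma size_box d N (x : lattice d) : size (box N x) = (N ^ d)%N.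
Proof. by rewrite size_map -cardE card_ffun !card_ord. Qed.

Definition box_avg (R : realFieldType) d N (f : lattice d -> R) (x : lattice d) : R :=
  (N ^ d)%:R^-1 * \sum_(y <- box N x) f y.

Lemma box_avg1 (R : realFieldType) d (f : lattice d -> R) x : box_avg 1 f x = f x.
Proof.
rewrite /box_avg exp1n invr1 mul1r big_box.
rewrite (big_pred1 [ffun=> ord0]) => [|u]; last first.
  by symmetry; apply/eqP/ffunP => i; rewrite [LHS]ord1 [RHS]ord1.
by congr f; apply/rowP => i; rewrite mxE ffunE addr0.
Qed.

Lemma dist_le_sum_steps (R : realFieldType) N (F H : nat -> R) a b :
  (forall s, `|F s.+1 - F s| <= H s) -> (a < N)%N -> (b < N)%N ->
  `|F a - F b| <= \sum_(s < N) H s.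
Proof.
move=> FH; wlog ab : a b / (a <= b)%N.
  move=> W aN bN; case/orP: (leq_total a b) => ?; first exact: W.
  by rewrite distrC W.
move=> aN bN; have H0 s : 0 <= H s by apply: le_trans (FH s).
rewrite distrC -telescope_sumr//; apply: le_trans (ler_norm_sum _ _ _) _.
apply: (@le_trans _ _ (\sum_(a <= s < b) H s)); first by apply: ler_sum.
rewrite -(big_mkord xpredT) (@big_cat_nat _ _ _ a 0 N)//= ?(ltnW aN)//.
rewrite (@big_cat_nat _ _ _ b a N)//= ?(ltnW bN)//.
have := @sumr_ge0 R _ (index_iota 0 a) xpredT H (fun i _ => H0 i).
have := @sumr_ge0 R _ (index_iota b N) xpredT H (fun i _ => H0 i).
lra.
Qed.

(** The difference of the two means is a mean of [f y - f z] over pairs; enlarging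
the smaller box to the larger one, [grid_poincare] applies at the cost of a ratio
of volumes. *)
Lemma box_avg_diff (R : realFieldType) d M N (f h : lattice d -> R) x :
  (forall y i, `|f (y + delta_mx 0 i) - f y| <= h y) -> (0 < M <= N)%N ->
  `|box_avg M f x - box_avg N f x| <=
    (d * N)%:R / (M ^ d)%:R * \sum_(y <- box N x) h y.
Proof.
move=> fh /andP[M0 MN].
have line (u : {ffun 'I_d -> 'I_N}) i t :
    `|f (box_point x u) - f (box_point x (set_coord u i t))| <=
      \sum_s h (box_point x (set_coord u i s)).
  pose z (s : nat) : lattice d := \row_j (x 0 j + (if j == i then s else u j)%:Z).
  have zE s : box_point x (set_coord u i s) = z s.
    by apply/rowP => j; rewrite !mxE ffunE; case: eqP.
  have uE : box_point x u = z (u i).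
    by apply/rowP => j; rewrite !mxE; case: eqP => // ->.
  under eq_bigr do rewrite zE; rewrite uE zE.
  apply: (@dist_le_sum_steps R N (f \o z) (h \o z)) => // s.
  rewrite /= -(_ : z s + delta_mx 0 i = z s.+1) //.
  by apply/rowP => j; rewrite !mxE /= eq_sym; case: eqP => //= _; lia.
have N0 : (0 < N)%N by apply: leq_trans MN.
have Md0 : ((M ^ d)%:R : R) != 0 by rewrite pnatr_eq0 expn_eq0; lia.
have Nd0 : ((N ^ d)%:R : R) != 0 by rewrite pnatr_eq0 expn_eq0; lia.
have -> : box_avg M f x - box_avg N f x =
    (M ^ d)%:R^-1 * ((N ^ d)%:R^-1 *
      \sum_(y <- box M x) \sum_(z <- box N x) (f y - f z)).
  rewrite (eq_bigr (fun y => (N ^ d)%:R * f y - \sum_(z <- box N x) f z)); last first.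
    by move=> y _; rewrite sumrB big_const_seq count_predT size_box iter_addr_0 mulr_natl.
  rewrite sumrB big_const_seq count_predT size_box iter_addr_0 -mulr_sumr.
  rewrite -(mulr_natl (\sum_(z <- box N x) f z)).
  rewrite /box_avg; move: Md0 Nd0; move: (M ^ d)%:R (N ^ d)%:R => a b a0 b0.
  by field; rewrite a0 b0.
have poincare : `|\sum_(y <- box M x) \sum_(z <- box N x) (f y - f z)| <=
    (d * N ^ d.+1)%:R * \sum_(y <- box N x) h y.
  apply: le_trans (ler_norm_sum _ _ _) _.
  apply: (@le_trans _ _ (\sum_(y <- box N x) `|\sum_(z <- box N x) (f y - f z)|)).
    apply: (@ler_sum_sub _ _ _ _ (fun y => `|\sum_(z <- box N x) (f y - f z)|)) => //.
      exact: box_uniq.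
    by move=> y; rewrite !mem_box => /forallP yx; apply/forallP => i; have := yx i; lia.
  rewrite !big_box -[in (N ^ _)%N](card_ord N).
  apply: le_trans (grid_poincare line); apply: ler_sum => u _.
  by rewrite big_box; exact: ler_norm_sum.
rewrite !normrM !normfV !normr_nat -mulrA [leRHS]mulrCA.
rewrite ler_wpM2l ?invr_ge0 ?ler0n// ler_pdivrMl ?lt0r ?Nd0 ?ler0n//.
apply: le_trans poincare _.
by rewrite mulrA -natrM expnSr mulnCA mulnA.
Qed.

(** * The weak-type estimate *)

(** The sum runs over pairs (point of [A], displacement). For a fixed point the
displaced points are distinct, and likewise for a fixed displacement; so both
numbers of choices bound how often the total mass [D] is counted. *)
Lemma sum_box_translates (R : realFieldType) d N (A : seq (lattice d))
    (G : lattice d -> R) (D : R) :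
  uniq A -> (forall s, uniq s -> \sum_(y <- s) G y <= D) ->
  \sum_(x <- A) \sum_(y <- box N x) G y <= (minn (size A) (N ^ d))%:R * D.
Proof.
move=> uA GD.
have byA : \sum_(x <- A) \sum_(y <- box N x) G y <= (size A)%:R * D.
  rewrite mulr_natl -[D *+ _]iter_addr_0 -count_predT -big_const_seq.
  by apply: ler_sum => x _; apply: GD; exact: box_uniq.
have byN : \sum_(x <- A) \sum_(y <- box N x) G y <= (N ^ d)%:R * D.
  under eq_bigr do rewrite big_box.
  rewrite exchange_big /=.
  have -> : (N ^ d)%:R * D = \sum_(u : {ffun 'I_d -> 'I_N}) D.
    by rewrite sumr_const card_ffun !card_ord mulr_natl.
  apply: ler_sum => u _.
  rewrite -(big_map (fun x => box_point x u) xpredT G).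
  by apply: GD; rewrite map_inj_uniq//; exact: box_point_injl.
by case: (leqP (size A) (N ^ d)).
Qed.

Lemma sum_half_dist (R : realFieldType) K k0 :
  \sum_(k < K) (2^-1 : R) ^+ ((k - k0) + (k0 - k)) <= 3.
Proof.
have pos n : 0 <= (2^-1 : R) ^+ n by apply: exprn_ge0; lra.
have small j : (j <= k0)%N ->
    \sum_(k < j) (2^-1 : R) ^+ ((k - k0) + (k0 - k)) <= 2^-1 ^+ (k0 - j).
  elim: j => [|j IH] jk; first by rewrite big_ord0.
  rewrite big_ord_recr /=; have := IH (ltnW jk).
  have -> : (j - k0 + (k0 - j) = (k0 - j.+1).+1)%N by lia.
  have -> : (k0 - j = (k0 - j.+1).+1)%N by lia.
  by rewrite exprS; lra.
have large i : \sum_(k < k0 + i.+1) (2^-1 : R) ^+ ((k - k0) + (k0 - k)) <=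
    3 - 2^-1 ^+ i.
  elim: i => [|i IH].
    rewrite addn1 big_ord_recr /=; have := small _ (leqnn k0).
    by rewrite subnn !expr0; lra.
  rewrite addnS big_ord_recr /=.
  have -> : (k0 + i.+1 - k0 + (k0 - (k0 + i.+1)) = i.+1)%N by lia.
  by move: IH; rewrite exprS; lra.
case: (leqP K k0) => Kk.
  apply: le_trans (small _ Kk) _.
  have : (2^-1 : R) ^+ (k0 - K) <= 1 by apply: exprn_ile1; lra.
  lra.
have -> : K = (k0 + (K - k0.+1).+1)%N by lia.
by apply: le_trans (large _) _; have := pos (K - k0.+1)%N; lra.
Qed.

(** The decay of the [k]-th scale away from the critical scale [k0], written with
integer powers of 2. Boxes of side 4^k make the square roots in the decay rates
exact: above [k0] the rate is 2^(d - 2), hence at least 2 as soon as [3 <= d]. *)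
Lemma scale_exponents d k k0 : (3 <= d)%N ->
  (4 ^ k.+1 * 2 ^ ((minn k k0).+1 * d) * 2 ^ (k.+1 * d) *
     2 ^ ((k - k0) + (k0 - k)) <= 4 ^ d * 4 ^ k0.+1 * 4 ^ (k * d))%N.
Proof.
move=> d3; rewrite -[4%N]/(2 ^ 2)%N -!expnM -!expnD leq_exp2l//.
case: (leqP k k0) => kk.
  have -> : k0 = (k + (k0 - k))%N by lia.
  by move: (k0 - k)%N => j; nia.
have -> : k = (k0 + (k - k0))%N by lia.
by move: (k - k0)%N => j; nia.
Qed.

Lemma exists_pow_ge (R : archiRealFieldType) (b : nat) (c M : R) :
  (1 < b)%N -> 0 < c -> exists K, M <= c * b%:R ^+ K.
Proof.
move=> b1 c0; exists (Num.Def.archi_bound `|M / c|).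
rewrite mulrC -ler_pdivrMr//.
apply/(le_trans (ler_norm _))/(le_trans (ltW (archi_boundP (normr_ge0 _)))).
by rewrite -natrX ler_nat ltnW// ltn_expl.
Qed.

Definition weak_const (R : realFieldType) d : R := (24 * d%:R) ^+ 2 * 48 ^+ d.

Lemma weak_const_ge0 (R : realFieldType) d : 0 <= weak_const R d.
Proof. by apply: mulr_ge0; [exact: sqr_ge0 | exact/exprn_ge0/ler0n]. Qed.

(** The weak-type bound, raised to the power [d - 2] so that only integer
exponents occur. [G] plays the role of the energy density and [V] that of [nu];
(3N)^d is the volume bound of the centred cube that contains a box of side N, over
which the maximal function controls the mean. The proof sums the increments of the
box means over the scales; the critical scale is 4^[k0] ~ (size A)^(1/d). *)
Lemma weak_estimate (R : realType) d (A : seq (lattice d))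
    (f G V : lattice d -> R) (D g lam : R) :
  (3 <= d)%N -> uniq A -> (forall y, 0 <= G y) -> (forall y, 0 <= V y) ->
  (forall y i, (f (y + delta_mx 0 i) - f y) ^+ 2 <= G y * V y) ->
  (forall s, uniq s -> \sum_(y <- s) G y <= D) ->
  (exists M, forall s, uniq s -> \sum_(y <- s) `|f y| <= M) ->
  0 <= g ->
  (forall x N, x \in A -> (0 < N)%N -> \sum_(y <- box N x) V y <= ((3 * N) ^ d)%:R * g) ->
  0 < lam -> (forall x, x \in A -> lam <= f x) ->
  (size A)%:R ^+ (d - 2) * lam ^+ (2 * d) <= (weak_const R d * g * D) ^+ d.
Proof.
move=> d3 uA G0 V0 fGV GD [M fM] g0 VA lam0 lamf.
have D0 : 0 <= D by have := GD [::] isT; rewrite big_nil.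
have wc0 := weak_const_ge0 R d.
case: (posnP (size A)) => [->|n0].
  rewrite expr0n gtn_eqF ?subn_gt0// mul0r.
  exact: exprn_ge0 (mulr_ge0 (mulr_ge0 wc0 g0) D0).
set n := size A in n0 *.
pose h y := Num.sqrt (G y * V y).
have fh y i : `|f (y + delta_mx 0 i) - f y| <= h y.
  by rewrite -sqrtr_sqr ler_wsqrtr.
have base : (1 < 4 ^ d)%N by rewrite -(expn0 4) ltn_exp2l//; lia.
pose k0 := trunc_log (4 ^ d) n.
have /andP[k0n nk0] := trunc_log_bounds base n0; rewrite -/k0 -!expnM in k0n nk0.
pose B := Num.sqrt (3 ^+ d * g * D * n%:R).
have B0 : 0 <= B by exact: sqrtr_ge0.
have BE : B ^+ 2 = 3 ^+ d * g * D * n%:R.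
  by rewrite sqr_sqrtr// !mulr_ge0// exprn_ge0.
(* Cauchy-Schwarz at scale k; the factor min(n, N^d) is what makes the small and
   the large scales summable. *)
have energy k : \sum_(x <- A) \sum_(y <- box (4 ^ k.+1) x) h y <=
    (2 ^ ((minn k k0).+1 * d) * 2 ^ (k.+1 * d))%:R * B.
  rewrite -(@ler_pXn2r _ 2) ?nnegrE ?mulr_ge0 ?sumr_ge0//; last first.
    by move=> x _; rewrite sumr_ge0// => y _; exact: sqrtr_ge0.
  rewrite exprMn BE -(natrX R (2 ^ ((minn k k0).+1 * d) * 2 ^ (k.+1 * d))%N 2).
  have flat (F : lattice d -> R) : \sum_(x <- A) \sum_(y <- box (4 ^ k.+1) x) F y =
      \sum_(y <- flatten [seq box (4 ^ k.+1) x | x <- A]) F y.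
    by rewrite big_flatten big_map.
  rewrite flat; apply: (le_trans (sum_sqr_le_prod (a := G) (b := V) _ _ _ _ _)) => //.
  - by move=> y; exact: sqrtr_ge0.
  - by move=> y; rewrite sqr_sqrtr// mulr_ge0.
  rewrite -!flat.
  have VV : \sum_(x <- A) \sum_(y <- box (4 ^ k.+1) x) V y <=
      n%:R * (((3 * 4 ^ k.+1) ^ d)%:R * g).
    rewrite mulr_natl -iter_addr_0 /n -count_predT -big_const_seq.
    rewrite big_seq [leRHS]big_seq; apply: ler_sum => x xA; apply: VA => //.
    by rewrite expn_gt0.
  apply: le_trans (ler_pM _ _ (sum_box_translates _ uA GD) VV) _.
  - by apply: sumr_ge0 => x _; exact: sumr_ge0.
  - by apply: sumr_ge0 => x _; exact: sumr_ge0.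
  rewrite -/n.
  have card : (minn n ((4 ^ k.+1) ^ d) * (4 ^ k.+1) ^ d <=
      (2 ^ ((minn k k0).+1 * d) * 2 ^ (k.+1 * d)) ^ 2)%N.
    rewrite expnMn -!expnM !(mulnC _ 2%N) !(expnM 2 2) -[(2 ^ 2)%N]/4%N leq_mul//.
    case: (leqP k k0) => _; first by rewrite geq_minr.
    by apply: leq_trans (geq_minl _ _) _; apply: ltnW; rewrite mulnC.
  have -> : (minn n ((4 ^ k.+1) ^ d))%:R * D * (n%:R * (((3 * 4 ^ k.+1) ^ d)%:R * g)) =
      (minn n ((4 ^ k.+1) ^ d) * (4 ^ k.+1) ^ d)%:R * (3 ^+ d * g * D * n%:R) :> R.
    by rewrite expnMn !natrM natrX; ring.
  by rewrite ler_wpM2r ?ler_nat// !mulr_ge0// exprn_ge0.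
pose T k := \sum_(x <- A) `|box_avg (4 ^ k) f x - box_avg (4 ^ k.+1) f x|.
pose E := d%:R * 4 ^+ d * B * 4 ^+ k0.+1.
have E0 : 0 <= E by rewrite !mulr_ge0 ?exprn_ge0.
have TE k : T k <= E * 2^-1 ^+ ((k - k0) + (k0 - k)).
  have T1 : T k <= (d * 4 ^ k.+1)%:R / ((4 ^ k) ^ d)%:R *
      \sum_(x <- A) \sum_(y <- box (4 ^ k.+1) x) h y.
    rewrite mulr_sumr; apply: ler_sum => x _; apply: box_avg_diff => //.
    by rewrite expn_gt0 leq_exp2l//= leqnSn.
  apply: le_trans T1 _; apply: (@le_trans _ _ ((d * 4 ^ k.+1)%:R / ((4 ^ k) ^ d)%:R *
     ((2 ^ ((minn k k0).+1 * d) * 2 ^ (k.+1 * d))%:R * B))).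
    by rewrite ler_wpM2l// divr_ge0.
  have p2 : 0 < (2 : R) ^+ ((k - k0) + (k0 - k)) by apply: exprn_gt0; lra.
  have p4 : 0 < ((4 ^ k) ^ d)%:R :> R by rewrite ltr0n !expn_gt0.
  rewrite exprVn ler_pdivlMr// [_ / ((4 ^ k) ^ d)%:R]mulrC -!mulrA ler_pdivrMl//.
  have := scale_exponents k k0 d3; rewrite -(ler_nat R) => /(ler_wpM2l (mulr_ge0 (ler0n R d) B0)).
  congr (_ <= _).
    by rewrite !natrM !natrX; ring.
  by rewrite !natrM !natrX /E -exprM; ring.
have [K MK] : exists K, M <= lam / 2 * (4 ^ d)%:R ^+ K.
  by apply: exists_pow_ge => //; lra.
(* At scale K the mean of f is negligible with respect to lam. *)
have tail x : `|box_avg (4 ^ K) f x| <= lam / 2.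
  rewrite /box_avg normrM normfV normr_nat ler_pdivrMl ?ltr0n ?expn_gt0//.
  apply: le_trans (ler_norm_sum _ _ _) _; apply: le_trans (fM _ (box_uniq _ _)) _.
  by apply: le_trans MK _; rewrite mulrC -natrX -!expnM mulnC.
have main : n%:R * lam <= 6 * E.
  have tele x : f x = \sum_(0 <= k < K)
      (box_avg (4 ^ k) f x - box_avg (4 ^ k.+1) f x) + box_avg (4 ^ K) f x.
    under eq_bigr do rewrite -opprB.
    by rewrite sumrN telescope_sumr// expn0 box_avg1; ring.
  have point x : x \in A -> lam / 2 <=
      \sum_(k < K) `|box_avg (4 ^ k) f x - box_avg (4 ^ k.+1) f x|.
    move=> /lamf; rewrite {1}tele big_mkord.
    have : \sum_(i < K) (box_avg (4 ^ i) f x - box_avg (4 ^ i.+1) f x) <=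
        \sum_(i < K) `|box_avg (4 ^ i) f x - box_avg (4 ^ i.+1) f x|.
      by apply: ler_sum => i _; exact: ler_norm.
    have := tail x; have := ler_norm (box_avg (4 ^ K) f x); lra.
  have sumT : n%:R * (lam / 2) <= \sum_(k < K) T k.
    rewrite exchange_big /= mulr_natl -iter_addr_0 /n -count_predT -big_const_seq.
    by rewrite big_seq [leRHS]big_seq; apply: ler_sum.
  have : \sum_(k < K) T k <= E * 3.
    apply: (@le_trans _ _ (\sum_(k < K) E * 2^-1 ^+ ((k - k0) + (k0 - k)))).
      by apply: ler_sum => i _; exact: TE.
    by rewrite -mulr_sumr ler_wpM2l// sum_half_dist.
  lra.
(* 24^2/16 = 6^2, where 6 = 2 * 3 comes from lam / 2 and the geometric series; a
   factor 16 comes back when the critical scale is eliminated. *)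
pose K1 : R := (24 * d%:R) ^+ 2 / 16 * 16 ^+ d * 3 ^+ d.
have n0' : 0 < n%:R :> R by rewrite ltr0n.
have square : n%:R * lam ^+ 2 <= K1 * g * D * (4 ^+ k0.+1) ^+ 2.
  have : (n%:R * lam) ^+ 2 <= (6 * E) ^+ 2.
    by rewrite ler_pXn2r// ?nnegrE ?mulr_ge0// ltW.
  have -> : (n%:R * lam) ^+ 2 = n%:R * (n%:R * lam ^+ 2) by ring.
  have -> : (6 * E) ^+ 2 = n%:R * (K1 * g * D * (4 ^+ k0.+1) ^+ 2).
    have -> : (6 * E) ^+ 2 = 36 * d%:R ^+ 2 * (4 ^+ d) ^+ 2 * (4 ^+ k0.+1) ^+ 2 * B ^+ 2.
      by rewrite /E; ring.
    have e16 : (4 ^+ d) ^+ 2 = 16 ^+ d :> R.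
      by rewrite -exprM mulnC exprM; congr (_ ^+ _); ring.
    by rewrite BE e16 /K1; field.
  by rewrite ler_pM2l.
(* Elimination of the critical scale: (4^(k0+1))^d is comparable to n. *)
have scale : (4 ^+ k0.+1 : R) ^+ d <= 4 ^+ d * n%:R.
  rewrite -!natrX -natrM ler_nat -expnM mulnC mulnS expnD.
  by rewrite leq_mul2l k0n orbT.
rewrite -(@ler_pM2l _ (n%:R ^+ 2)) ?exprn_gt0//.
have -> : n%:R ^+ 2 * (n%:R ^+ (d - 2) * lam ^+ (2 * d)) = (n%:R * lam ^+ 2) ^+ d.
  by rewrite mulrA -exprD subnKC ?(ltnW d3)// exprMn exprM.
have K10 : 0 <= K1 by rewrite /K1 !mulr_ge0 ?exprn_ge0 ?invr_ge0 ?ler0n.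
apply: (@le_trans _ _ ((K1 * g * D * (4 ^+ k0.+1) ^+ 2) ^+ d)).
  by apply: lerXn2r square; rewrite nnegrE !mulr_ge0 ?exprn_ge0// ltW.
have -> : (K1 * g * D * (4 ^+ k0.+1) ^+ 2) ^+ d =
    (K1 * g * D) ^+ d * ((4 ^+ k0.+1) ^+ d) ^+ 2.
  by rewrite exprMn (exprAC _ 2 d).
apply: (@le_trans _ _ ((K1 * g * D) ^+ d * (4 ^+ d * n%:R) ^+ 2)).
  rewrite ler_wpM2l ?exprn_ge0 ?mulr_ge0//.
  by apply: lerXn2r scale; rewrite nnegrE ?mulr_ge0 ?exprn_ge0.
have e16 : (4 ^+ d) ^+ 2 = 16 ^+ d :> R.
  by rewrite -exprM mulnC exprM; congr (_ ^+ _); ring.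
have -> : (K1 * g * D) ^+ d * (4 ^+ d * n%:R) ^+ 2 =
    n%:R ^+ 2 * (16 * (K1 * g * D)) ^+ d.
  by rewrite [(16 * _) ^+ d]exprMn -e16; ring.
have -> : weak_const R d * g * D = 16 * (K1 * g * D).
  rewrite /weak_const /K1; have -> : (48 : R) = 16 * 3 by ring.
  by rewrite [(16 * 3) ^+ d]exprMn; field.
by [].
Qed.

(** * The maximal function and the Dirichlet form over finite sequences *)

(** The centred cube of radius [N] as a box, hence as an explicit sequence of
known length. *)
Definition cube_seq (d N : nat) (z : lattice d) : seq (lattice d) :=
  box N.*2.+1 (\row_i (z 0 i - N%:Z)).

Lemma mem_cube_seq d N (z y : lattice d) :
  (y \in cube_seq N z) = [forall i, `|y 0 i - z 0 i| <= N%:Z].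
Proof.
rewrite mem_box; apply: eq_forallb => i; rewrite mxE.
by move: (y 0 i) (z 0 i) => a b; lia.
Qed.

Lemma cube_cube_seq (R : realType) d N (z : lattice d) :
  cube z (N%:R : R) = [set` cube_seq N z].
Proof.
apply/seteqP; split => y /=; rewrite mem_cube_seq.
  by move=> yz; apply/forallP => i; have := yz i; rewrite -intr_norm -[N%:R]/(N%:~R) ler_int.
by move=> /forallP yz i; have := yz i; rewrite -intr_norm -[N%:R]/(N%:~R) ler_int.
Qed.

Definition nbr_seq d (x : lattice d) : seq (lattice d) := [seq y <- cube_seq 1 x | nbr x y].

Lemma nbr_cube_seq d (x y : lattice d) : nbr x y -> y \in cube_seq 1 x.
Proof.
move=> /eqP xy; rewrite mem_cube_seq; apply/forallP => i.
rewrite distrC -[leRHS]xy (bigD1 i)//= lerDl; exact: sumr_ge0.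
Qed.

Lemma mem_nbr_seq d (x y : lattice d) : (y \in nbr_seq x) = nbr x y.
Proof.
by rewrite mem_filter; case xy : (nbr x y) => //=; exact: nbr_cube_seq.
Qed.

Lemma nbrs_seq d (x : lattice d) : nbrs x = [set` nbr_seq x].
Proof. by apply/seteqP; split => y /=; rewrite mem_nbr_seq. Qed.

Lemma nbr_seq_uniq d (x : lattice d) : uniq (nbr_seq x).
Proof. by rewrite filter_uniq// box_uniq. Qed.

Lemma nbrC d (x y : lattice d) : nbr x y = nbr y x.
Proof. by rewrite /nbr; under eq_bigr do rewrite distrC. Qed.

Lemma nbr_delta d (x : lattice d) i : nbr x (x + delta_mx 0 i).
Proof.
rewrite /nbr (bigD1 i)//= big1 => [|j ji]; rewrite !mxE /= ?eqxx ?(negPf ji).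
  by rewrite addr0 opprD addrA subrr sub0r normrN normr1.
by rewrite addr0 subrr normr0.
Qed.

Lemma nuE (R : realType) d (w : lattice d -> lattice d -> R) x :
  nu w x = \sum_(y <- nbr_seq x) (w x y)^-1.
Proof. by rewrite /nu nbrs_seq -fsbig_seq// nbr_seq_uniq. Qed.

Lemma average_cube (R : realType) d N (z : lattice d) (h : lattice d -> R) :
  average (cube z (N%:R : R)) h = (N.*2.+1 ^ d)%:R^-1 * \sum_(y <- cube_seq N z) h y.
Proof.
rewrite /average cube_cube_seq -fsbig_seq ?box_uniq//; congr (_%:R^-1 * _).
rewrite -(size_box N.*2.+1 (\row_i (z 0 i - N%:Z))) -/(cube_seq N z).
rewrite -(undup_id (box_uniq _ _ : uniq (cube_seq N z))) -card_fseq; congr (#|` _|)%fset.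
apply/fsetP => y; rewrite in_fset_set; last exact: finite_seq.
by rewrite mem_setE mem_undup !inE.
Qed.

(** Finiteness of the maximal function is what turns the supremum of extended reals
into a bound between reals. *)
Lemma fine_maximal_ge (R : realType) d (h : lattice d -> R) x (z : lattice d) N :
  (maximal h x < +oo)%E -> x \in cube_seq N z ->
  (N.*2.+1 ^ d)%:R^-1 * \sum_(y <- cube_seq N z) h y <= fine (maximal h x).
Proof.
move=> fin xz; rewrite -average_cube.
have le : ((average (cube z (N%:R : R)) h)%:E <= maximal h x)%E.
  apply: ereal_sup_ubound; exists z, N%:R; split=> //.
  by rewrite cube_cube_seq.
rewrite -lee_fin fineK// fin_real// fin andbT; exact: lt_le_trans (ltNyr _) le.
Qed.

Section Conductance.
Variables (R : realType) (d : nat) (w : lattice d -> lattice d -> R).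
Hypothesis w_cond : conductance w.

Lemma conductance_ge0 x y : 0 <= w x y.
Proof.
by case: w_cond => _ p z; case xy : (nbr x y); [exact/ltW/p | rewrite z ?xy].
Qed.

Lemma nu_ge0 x : 0 <= nu w x.
Proof. by rewrite nuE sumr_ge0// => y _; rewrite invr_ge0 conductance_ge0. Qed.

Lemma inv_le_nu x y : nbr x y -> (w x y)^-1 <= nu w x.
Proof.
move=> xy; rewrite nuE (big_rem y) ?mem_nbr_seq//= lerDl sumr_ge0// => z _.
by rewrite invr_ge0 conductance_ge0.
Qed.

(** The cube of radius 0 already contributes [nu w x + 1]. *)
Lemma maximal_ge1 x : (maximal (fun y => nu w y + 1)%R x < +oo)%E ->
  1 <= fine (maximal (fun y => nu w y + 1)%R x).
Proof.
move=> fin; have x0 : x \in cube_seq 0 x.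
  by rewrite mem_cube_seq; apply/forallP => i; rewrite subrr normr0.
apply: le_trans (fine_maximal_ge fin x0).
rewrite exp1n invr1 mul1r (big_rem x)//= -[leLHS]addr0 lerD//.
  by rewrite lerDr nu_ge0.
by rewrite sumr_ge0// => y _; rewrite addr_ge0// nu_ge0.
Qed.

(** The box with lowest corner [x] lies in the centred cube of radius [N], which has
(2N + 1)^d <= (3N)^d points. *)
Lemma sum_nu_box x N : (maximal (fun y => nu w y + 1)%R x < +oo)%E -> (0 < N)%N ->
  \sum_(y <- box N x) nu w y <=
    ((3 * N) ^ d)%:R * fine (maximal (fun y => nu w y + 1)%R x).
Proof.
move=> fin N0; have xN : x \in cube_seq N x.
  by rewrite mem_cube_seq; apply/forallP => i; rewrite subrr normr0.
have := fine_maximal_ge fin xN; rewrite ler_pdivrMl ?ltr0n ?expn_gt0//.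
move=> h; apply: le_trans (le_trans _ h) _.
  apply: (@le_trans _ _ (\sum_(y <- cube_seq N x) nu w y)).
    apply: ler_sum_sub nu_ge0; first exact: box_uniq.
    move=> y; rewrite mem_box mem_cube_seq => /forallP yx; apply/forallP => i.
    by have := yx i; move: (y 0 i) (x 0 i) => a b; lia.
  by apply: ler_sum => y _; rewrite lerDl.
have := maximal_ge1 fin => m1; rewrite ler_wpM2r ?(le_trans ler01 m1)// ler_nat.
by case: (posnP d) => [->//|d0]; rewrite leq_exp2r//; lia.
Qed.

Definition energy_at (f : lattice d -> R) x : R :=
  \sum_(y <- nbr_seq x) w x y * (f y - f x) * (f y - f x).

Lemma dirichletE f : dirichlet w f f =
  2^-1 * \sum_(x \in [set: lattice d]) energy_at f x.
Proof.
congr (_ * _); apply: eq_fsbigr => x _.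
by rewrite nbrs_seq -fsbig_seq// nbr_seq_uniq.
Qed.

Lemma energy_at_term_ge0 (f : lattice d -> R) x y : 0 <= w x y * (f y - f x) * (f y - f x).
Proof. by rewrite -mulrA mulr_ge0 ?conductance_ge0// -expr2 sqr_ge0. Qed.

Lemma energy_at_ge0 f x : 0 <= energy_at f x.
Proof. by rewrite sumr_ge0// => y _; exact: energy_at_term_ge0. Qed.

(** Both factors contain the term of the edge between [x] and [x + e_i], and there
the conductance cancels. *)
Lemma gradient_le_energy f x i :
  (f (x + delta_mx 0 i) - f x) ^+ 2 <= energy_at f x * nu w x.
Proof.
set y := x + delta_mx 0 i; have xy : nbr x y by exact: nbr_delta.
have w0 : 0 < w x y by case: w_cond => _ p _; exact: p.
have -> : (f y - f x) ^+ 2 = w x y * (f y - f x) * (f y - f x) * (w x y)^-1.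
  by field; rewrite gt_eqF.
apply: ler_pM; rewrite ?invr_ge0 ?conductance_ge0 ?energy_at_term_ge0 ?inv_le_nu//.
rewrite /energy_at (big_rem y) ?mem_nbr_seq//= lerDl sumr_ge0// => z _.
exact: energy_at_term_ge0.
Qed.

(** A finite set that carries the energy density of every function supported in
[S], so that the energies of several such functions are sums over one
index set. *)
Definition closed_nbhd (S : seq (lattice d)) := undup (flatten [seq cube_seq 1 x | x <- S]).

Lemma energy_at_eq0 (S : seq (lattice d)) f x :
  (forall x, f x != 0 -> x \in S) -> x \notin closed_nbhd S -> energy_at f x = 0.
Proof.
move=> fS; rewrite mem_undup => xS.
have f0 y : x \in cube_seq 1 y -> f y = 0.
  move=> xy; apply/eqP/negPn/negP => /fS yS; move/negP: xS; apply.
  by apply/flattenP; exists (cube_seq 1 y) => //; exact: map_f.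
rewrite /energy_at big_seq big1// => y; rewrite mem_nbr_seq nbrC => /nbr_cube_seq xy.
rewrite (f0 _ xy) (f0 x) ?subrr ?mulr0//.
by rewrite mem_cube_seq; apply/forallP => i; rewrite subrr normr0.
Qed.

Lemma dirichlet_seq (S : seq (lattice d)) f :
  (forall x, f x != 0 -> x \in S) ->
  2 * dirichlet w f f = \sum_(x <- closed_nbhd S) energy_at f x.
Proof.
move=> fS; rewrite dirichletE mulrA divff ?mul1r ?pnatr_eq0//.
rewrite [RHS]fsbig_seq ?undup_uniq//; apply/esym.
apply: (fsbig_widen [set` closed_nbhd S] setT) => // x [_ /negP xS] /=.
exact: energy_at_eq0 fS xS.
Qed.

Lemma energy_le_dirichlet (S : seq (lattice d)) f s :
  (forall x, f x != 0 -> x \in S) -> uniq s ->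
  \sum_(x <- s) energy_at f x <= 2 * dirichlet w f f.
Proof.
move=> fS us; rewrite (dirichlet_seq fS).
have -> : \sum_(x <- s) energy_at f x =
    \sum_(x <- [seq x <- s | x \in closed_nbhd S]) energy_at f x.
  rewrite big_filter [LHS](bigID (mem (closed_nbhd S))) /= [X in _ + X]big1 ?addr0//.
  by move=> x; exact: energy_at_eq0.
apply: ler_sum_sub => [||x]; first exact: filter_uniq.
  by move=> x; rewrite mem_filter => /andP[].
exact: energy_at_ge0.
Qed.

End Conductance.

(** * Truncation and dyadic layers *)

Lemma dyadic_level (R : realDomainType) (c t : R) J :
  c <= t -> t < c * 2 ^+ J ->
  exists2 j, (j < J)%N & c * 2 ^+ j <= t < c * 2 ^+ j.+1.
Proof.
move=> ct; elim: J => [|J IH]; first by rewrite expr0 mulr1 ltNge ct.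
move=> tJ; case: (ltP t (c * 2 ^+ J)) => [/IH[j jJ tj]|Jt].
  by exists j => //; exact: ltnW.
by exists J => //; rewrite Jt.
Qed.

Lemma ub_seq (R : realDomainType) (T : eqType) (s : seq T) (F : T -> R) :
  exists M, forall x, x \in s -> F x <= M.
Proof.
elim: s => [|x s [M MF]]; first by exists 0.
exists (Num.max (F x) M) => y; rewrite inE le_max => /orP[/eqP ->|/MF ->].
  by rewrite lexx.
by rewrite orbT.
Qed.

Lemma pos_lb_seq (R : realDomainType) (T : eqType) (s : seq T) (F : T -> R) :
  (forall x, x \in s -> 0 < F x) ->
  exists2 c, 0 < c & forall x, x \in s -> c <= F x.
Proof.
elim: s => [|x s IH] F0; first by exists 1.
have [|c c0 cF] := IH; first by move=> y ys; apply: F0; rewrite inE ys orbT.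
exists (Num.min (F x) c); first by rewrite lt_min c0 F0 ?mem_head.
move=> y; rewrite inE ge_min => /orP[/eqP ->|/cF ->].
  by rewrite lexx.
by rewrite orbT.
Qed.

(** Each term is at most [a i] times the power [q - 1] of the total sum. *)
Lemma sum_powR_le (R : realType) (I : finType) (a : I -> R) q :
  1 <= q -> (forall i, 0 <= a i) -> \sum_i a i `^ q <= (\sum_i a i) `^ q.
Proof.
move=> q1 a0; have s0 : 0 <= \sum_i a i by exact: sumr_ge0.
have q0 : 0 < q by lra.
rewrite -(mulr_powRB1 s0 q0) mulr_suml; apply: ler_sum => i _.
rewrite -(mulr_powRB1 (a0 i) q0) ler_wpM2l//.
apply: ge0_ler_powR; rewrite ?nnegrE ?subr_ge0//.
by rewrite (bigD1 i)//= lerDl sumr_ge0.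
Qed.

(** The length of the part of the interval [c, 2 c] that lies below [t]. *)
Definition slice (R : realDomainType) (c t : R) := Num.min t (2 * c) - Num.min t c.

Lemma slice0 (R : realDomainType) (c : R) : 0 < c -> slice c 0 = 0.
Proof. by move=> c0; rewrite /slice !min_l ?subrr ?mulr_ge0// ltW. Qed.

Lemma slice_top (R : realFieldType) (c t : R) : 0 < c -> 2 * c <= t -> slice c t = c.
Proof. by move=> c0 ct; rewrite /slice !min_r//; lra. Qed.

Lemma slice_homo (R : realFieldType) (c : R) : 0 < c -> {homo slice c : x y / x <= y}.
Proof. by move=> c0 x y xy; rewrite /slice !minElt; do 4?case: ltP => ?; lra. Qed.

(** The increments of the slices have a common sign, so their squares add up to at
most the square of their sum, and the slices themselves telescope. *)
Lemma sum_slice_sqr (R : realFieldType) (c a b : R) M : 0 < c ->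
  \sum_(k < M) (slice (c * 2 ^+ k) a - slice (c * 2 ^+ k) b) ^+ 2 <= (a - b) ^+ 2.
Proof.
move=> c0; wlog ba : a b / b <= a.
  move=> W; case/orP: (le_total b a) => ?; first exact: W.
  by under eq_bigr do rewrite -sqrrN opprB; rewrite -[leRHS]sqrrN opprB W.
have ck (k : nat) : 0 < c * 2 ^+ k by rewrite mulr_gt0// exprn_gt0.
have t0 (k : nat) : 0 <= slice (c * 2 ^+ k) a - slice (c * 2 ^+ k) b.
  by rewrite subr_ge0 slice_homo.
have tele t : \sum_(k < M) slice (c * 2 ^+ k) t = Num.min t (c * 2 ^+ M) - Num.min t c.
  rewrite -(big_mkord xpredT (fun k => slice (c * 2 ^+ k) t)).
  rewrite (telescope_sumr_eq (fun k => Num.min t (c * 2 ^+ k))) ?expr0 ?mulr1//.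
  by move=> k _; rewrite /slice exprS mulrCA.
set s := \sum_(k < M) (slice (c * 2 ^+ k) a - slice (c * 2 ^+ k) b).
have s0 : 0 <= s by apply: sumr_ge0.
have sab : s <= a - b.
  rewrite /s sumrB !tele !minElt.
  have cM : c <= c * 2 ^+ M.
    by rewrite ler_peMr ?(ltW c0)// exprn_ege1//; lra.
  by do 4?case: ltP => ?; lra.
apply: (@le_trans _ _ (s ^+ 2)).
  rewrite expr2 {1}/s mulr_suml; apply: ler_sum => k _; rewrite expr2 ler_wpM2l//.
  by rewrite /s (bigD1 k)//= lerDl sumr_ge0.
by rewrite ler_pXn2r// nnegrE subr_ge0.
Qed.

Section Levels.
Variables (R : realType) (d : nat) (w : lattice d -> lattice d -> R).
Hypotheses (hd : (3 <= d)%N) (w_cond : conductance w).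
Hypothesis max_fin : forall x : lattice d, (maximal (fun y => (nu w y + 1)%R) x < +oo)%E.

Let g x := fine (maximal (fun y => (nu w y + 1)%R) x).

(** [weak_estimate] for the energy density of [f], solved for the cardinality; the
exponent is p/2. *)
Lemma card_superlevel (S A : seq (lattice d)) f (G lam : R) :
  (forall x, f x != 0 -> x \in S) -> uniq A -> 0 < lam -> 0 <= G ->
  (forall x, x \in A -> lam <= f x) -> (forall x, x \in A -> g x <= G) ->
  (size A)%:R <= (weak_const R d * G * (2 * dirichlet w f f) / lam ^+ 2)
                   `^ (d%:R / (d%:R - 2)).
Proof.
move=> fS uA lam0 G0 lamf gG.
have D0 : 0 <= 2 * dirichlet w f f.
  by have := energy_le_dirichlet w_cond fS (erefl : uniq [::]); rewrite big_nil.
set D := 2 * _ in D0 *.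
have weak := @weak_estimate R d A f (energy_at w f) (nu w) D G lam hd uA
  (energy_at_ge0 w_cond f) (nu_ge0 w_cond) (gradient_le_energy w_cond f)
  (fun s => energy_le_dirichlet w_cond fS) _ G0 _ lam0 lamf.
have {}weak : (size A)%:R ^+ (d - 2) * lam ^+ (2 * d) <= (weak_const R d * G * D) ^+ d.
  apply: weak.
    exists (\sum_(y <- S) `|f y|) => s us.
    have -> : \sum_(y <- s) `|f y| = \sum_(y <- [seq y <- s | f y != 0]) `|f y|.
      rewrite big_filter [LHS](bigID (fun y => f y != 0)) /= [X in _ + X]big1 ?addr0//.
      by move=> y /negPn/eqP ->; rewrite normr0.
    apply: (@ler_sum_sub _ _ _ _ (fun y => `|f y|)) => //; first exact: filter_uniq.
    by move=> y; rewrite mem_filter => /andP[/fS].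
  move=> x N xA N0; apply: le_trans (sum_nu_box w_cond (max_fin x) N0) _.
  by rewrite ler_wpM2l//; exact: gG.
set X := weak_const R d * G * D in weak *.
have X0 : 0 <= X by exact: mulr_ge0 (mulr_ge0 (weak_const_ge0 R d) G0) D0.
have l2 : 0 < lam ^+ 2 by rewrite exprn_gt0.
have {}weak : (size A)%:R ^+ (d - 2) <= (X / lam ^+ 2) ^+ d.
  by rewrite expr_div_n ler_pdivlMr ?exprn_gt0// -exprM.
have d2 : (0 : R) < d%:R - 2 by rewrite subr_gt0 ltr_nat.
have d2E : d%:R - 2 = (d - 2)%:R :> R by rewrite natrB// ltnW.
have : ((size A)%:R ^+ (d - 2)) `^ (d%:R - 2)^-1 <=
    ((X / lam ^+ 2) ^+ d) `^ (d%:R - 2)^-1 :> R.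
  by apply: ge0_ler_powR; rewrite ?nnegrE ?exprn_ge0 ?invr_ge0 ?divr_ge0// ltW.
have Y0 : 0 <= X / lam ^+ 2 by rewrite divr_ge0// ltW.
rewrite -(powR_mulrn d Y0) -(powR_mulrn (d - 2) (ler0n R (size A))) -!powRrM.
by rewrite -d2E divff ?gt_eqF// powRr1.
Qed.

(** Slicing is energy efficient: no edge is charged twice for the same increment. *)
Lemma sum_dirichlet_slice (S : seq (lattice d)) f (c : R) M :
  (forall x, f x != 0 -> x \in S) -> 0 < c ->
  \sum_(k < M) (2 * dirichlet w (fun x => slice (c * 2 ^+ k) `|f x|)
                             (fun x => slice (c * 2 ^+ k) `|f x|))
    <= 2 * dirichlet w f f.
Proof.
move=> fS c0; have ck (k : nat) : 0 < c * 2 ^+ k by rewrite mulr_gt0// exprn_gt0.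
have supp (k : nat) x : slice (c * 2 ^+ k) `|f x| != 0 -> x \in S.
  move=> h; apply: fS; apply: contraNneq h => ->.
  by rewrite normr0 slice0.
under eq_bigr => k _ do rewrite (dirichlet_seq w (supp k)).
rewrite exchange_big (dirichlet_seq w fS) /=; apply: ler_sum => x _.
rewrite /energy_at exchange_big /=; apply: ler_sum => y _.
under eq_bigr do rewrite -mulrA -expr2.
rewrite -mulr_sumr -mulrA -expr2 ler_wpM2l ?conductance_ge0//.
apply: le_trans (sum_slice_sqr _ _ _ c0) _.
rewrite -[leLHS]real_normK ?num_real// -[leRHS]real_normK ?num_real//.
by rewrite ler_pXn2r ?nnegrE//; exact: ler_dist_dist.
Qed.

(** On the cell where [g] lies in [2^j, 2^(j+1)) and |f| in [2 c 2^k, 4 c 2^k) the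
slice of |f| at level [c 2^k] is saturated, and the weak estimate for it
controls the contribution of the cell by 2^(j (q - beta)) times its energy to the
power [q]. Both sums over the cells then converge. *)
Lemma weighted_sobolev_seq (S : seq (lattice d)) (f : lattice d -> R) (beta q : R) :
  q = d%:R / (d%:R - 2) -> q < beta ->
  uniq S -> (forall x, (x \in S) = (f x != 0)) ->
  \sum_(x <- S) g x `^ (- beta) * `|f x| `^ (2 * q) <=
    (32 * weak_const R d) `^ q / (1 - 2 `^ (q - beta)) * (2 * dirichlet w f f) `^ q.
Proof.
move=> qE qb uS Sf.
have fS x : f x != 0 -> x \in S by rewrite Sf.
have d3 : (3 : R) <= d%:R by rewrite ler_nat.
have q1 : 1 <= q by rewrite qE ler_pdivlMr; lra.
have g1 x : 1 <= g x by exact: maximal_ge1.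
have [c2 c20 c2f] : exists2 c, 0 < c & forall x, x \in S -> c <= `|f x|.
  by apply: pos_lb_seq => x; rewrite Sf normr_gt0.
(* Half of the least positive value of |f|: the slice at level c is saturated on
   the whole support, so the cells cover it. *)
pose c := c2 / 2; have c0 : 0 < c by rewrite divr_gt0.
have [M0 M0f] := ub_seq S (fun x => `|f x| + 1).
have [M M0M] := exists_pow_ge M0 (isT : (1 < 2)%N) c20.
have [J0 J0g] := ub_seq S (fun x => g x + 1).
have [J J0J] := exists_pow_ge J0 (isT : (1 < 2)%N) (ltr01 : 0 < 1 :> R).
have ck (k : nat) : 0 < c * 2 ^+ k by rewrite mulr_gt0// exprn_gt0.
pose fk (k : nat) x := slice (c * 2 ^+ k) `|f x|.
pose D k := 2 * dirichlet w (fk k) (fk k).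
have fkS (k : nat) x : fk k x != 0 -> x \in S.
  by move=> h; apply: fS; apply: contraNneq h => fx; rewrite /fk fx normr0 slice0.
have D0 k : 0 <= D k.
  by have := energy_le_dirichlet w_cond (@fkS k) (erefl : uniq [::]); rewrite big_nil.
pose A (j k : nat) := [seq x <- S | (g x <= 2 ^+ j.+1) && (2 * (c * 2 ^+ k) <= `|f x|)].
(* An upper bound for the summand on the cell (j, k). *)
pose B (j k : nat) : R := (2 ^+ j) `^ (- beta) * (4 * (c * 2 ^+ k)) `^ (2 * q).
have B0 j k : 0 <= B j k by rewrite mulr_ge0// powR_ge0.
have point x : x \in S -> g x `^ (- beta) * `|f x| `^ (2 * q) <=
    \sum_(j < J) \sum_(k < M) (x \in A j k)%:R * B j k.
  move=> xS.
  have [|j jJ /andP[gj1 gj2]] := @dyadic_level _ 1 (g x) J (g1 x).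
    by apply: lt_le_trans J0J; have := J0g _ xS; lra.
  have [|k kM /andP[fk1 fk2]] := @dyadic_level _ c2 `|f x| M (c2f x xS).
    by apply: lt_le_trans M0M; have := M0f _ xS; lra.
  rewrite !mul1r in gj1 gj2.
  have c2E : c2 = 2 * c by rewrite /c; field.
  have xA : x \in A j k.
    by rewrite mem_filter xS (ltW gj2) andbT /= mulrA -c2E.
  rewrite (bigD1 (Ordinal jJ))//= (bigD1 (Ordinal kM))//= xA mul1r -addrA.
  rewrite -[leLHS]addr0 lerD//.
    apply: ler_pM; rewrite ?powR_ge0//.
      rewrite !powRN lef_pV2 ?posrE ?powR_gt0 ?exprn_gt0//; last first.
        by apply: lt_le_trans (g1 x).
      apply: ge0_ler_powR; rewrite ?nnegrE ?exprn_ge0//; last by rewrite (le_trans ler01).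
      by lra.
    apply: ge0_ler_powR; rewrite ?nnegrE//; first by lra.
      by have := ck k; lra.
    by apply: le_trans (ltW fk2) _; rewrite exprS c2E; lra.
  by rewrite addr_ge0// !sumr_ge0// => *; rewrite ?sumr_ge0// => *; rewrite mulr_ge0.
pose r : R := 2 `^ (q - beta).
have r0 : 0 <= r by exact: powR_ge0.
have r1 : r < 1.
  rewrite /r -opprB powRN invf_lt1 ?powR_gt0//.
  have := @gt0_ltr_powR R (beta - q); rewrite subr_gt0 => /(_ qb 1 2).
  by rewrite powR1 !nnegrE; apply=> //; lra.
have cell j k : (size (A j k))%:R * B j k <=
    (32 * weak_const R d) `^ q * (r ^+ j * D k `^ q).
  have size_le := @card_superlevel S (A j k) (fk k) (2 ^+ j.+1) (c * 2 ^+ k) (@fkS k)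
    (filter_uniq _ uS) (ck k) (exprn_ge0 _ (ler0n R 2)).
  rewrite -qE in size_le.
  apply: le_trans (ler_wpM2r (B0 j k) (size_le _ _)) _.
  - move=> x; rewrite mem_filter => /andP[/andP[_ fx] _].
    by rewrite /fk slice_top.
  - by move=> x; rewrite mem_filter => /andP[/andP[]].
  have pw := weak_const_ge0 R d; have l0 := ck k.
  have pw32 : 0 <= 32 * weak_const R d by exact: mulr_ge0.
  have l4 : 0 <= 4 * (c * 2 ^+ k) by lra.
  have p2 i : 0 <= (2 : R) ^+ i by exact: exprn_ge0.
  have X0 : 0 <= weak_const R d * 2 ^+ j.+1 * D k / (c * 2 ^+ k) ^+ 2.
    exact: divr_ge0 (mulr_ge0 (mulr_ge0 pw (p2 _)) (D0 k)) (sqr_ge0 _).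
  rewrite -/(D k) /B (powRrM _ 2 q) (powR_mulrn 2 l4) mulrCA -(powRM _ X0 (sqr_ge0 _)).
  have -> : weak_const R d * 2 ^+ j.+1 * D k / (c * 2 ^+ k) ^+ 2 * (4 * (c * 2 ^+ k)) ^+ 2
      = 32 * weak_const R d * (2 ^+ j * D k).
    rewrite exprS; move: l0; move: (c * 2 ^+ k) => l l0.
    by field; rewrite gt_eqF.
  rewrite (powRM _ pw32 (mulr_ge0 (p2 j) (D0 k))) (powRM _ (p2 j) (D0 k)).
  rewrite mulrCA (mulrA ((2 ^+ j) `^ (- beta))).
  rewrite -powRD; last by rewrite expf_neq0 ?implybT.
  suff -> : r ^+ j = (2 ^+ j) `^ (- beta + q) by [].
  rewrite -(powR_mulrn j (ler0n R 2)) -(powR_mulrn j r0) /r -!powRrM.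
  by rewrite mulrC addrC.
apply: (@le_trans _ _ (\sum_(j < J) \sum_(k < M) (size (A j k))%:R * B j k)).
  apply: (@le_trans _ _ (\sum_(x <- S) \sum_(j < J) \sum_(k < M) (x \in A j k)%:R * B j k)).
    by rewrite big_seq [leRHS]big_seq; exact: ler_sum.
  rewrite exchange_big /=; apply: ler_sum => j _.
  rewrite exchange_big /=; apply: ler_sum => k _.
  rewrite -mulr_suml ler_wpM2r// size_filter -sum1_count natr_sum [leRHS]big_mkcond /=.
  rewrite big_seq [leRHS]big_seq; apply: ler_sum => x xS.
  by rewrite mem_filter xS andbT; case: ifP.
apply: (@le_trans _ _ (\sum_(j < J) \sum_(k < M)
    (32 * weak_const R d) `^ q * (r ^+ j * D k `^ q))).
  by apply: ler_sum => j _; apply: ler_sum => k _; exact: cell.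
under eq_bigr do rewrite -mulr_sumr -mulr_sumr.
rewrite -mulr_sumr -mulr_suml -mulrA ler_wpM2l ?powR_ge0//.
apply: ler_pM; rewrite ?sumr_ge0//.
- by move=> j _; exact: exprn_ge0.
- by move=> k _; exact: powR_ge0.
- rewrite -[leRHS]mulr1 -/r ler_pdivlMl; last by lra.
  have := subrX1 r J; have := exprn_ge0 J r0; rewrite -/r.
  by move: (\sum_(i < J) r ^+ i) => s; lra.
- apply: le_trans (sum_powR_le q1 (fun k : 'I_M => D0 k)) _.
  apply: ge0_ler_powR; rewrite ?nnegrE ?sumr_ge0//; first by lra.
    by have := energy_le_dirichlet w_cond fS (erefl : uniq [::]); rewrite big_nil.
  exact: (sum_dirichlet_slice M fS c0).
Qed.
End Levels.

(** * The weighted Sobolev inequality *)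

Theorem lemma1p5 (R : realType) (d : nat) (hd : (3 <= d)%N) (p beta : R)
    (hp : p = (2 * d%:R) / (d%:R - 2)) (hbeta : p / 2 < beta) :
  exists C : R,
    forall w : lattice d -> lattice d -> R, conductance w ->
    (forall x : lattice d, (maximal (fun y => (nu w y + 1)%R) x < +oo)%E) ->
    forall f : lattice d -> R, finite_set [set x | f x != 0] ->
      (\sum_(x \in [set: lattice d]) weight beta w x * `|f x| `^ p) `^ (2 / p)
        <= C * dirichlet w f f.
Proof.
have d3 : (3 : R) <= d%:R by rewrite ler_nat.
pose q : R := d%:R / (d%:R - 2).
have q1 : 1 <= q by rewrite ler_pdivlMr; lra.
have q0 : 0 < q by lra.
have pE : p = 2 * q by rewrite hp /q mulrA.
have qb : q < beta by move: hbeta; rewrite pE [X in X < _]mulrAC divff ?mul1r.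
pose K : R := (32 * weak_const R d) `^ q / (1 - 2 `^ (q - beta)).
exists (2 * K `^ q^-1) => w w_cond max_fin f /finite_seqP[s0 s0E].
pose S := undup s0; have uS : uniq S by exact: undup_uniq.
have Sf x : (x \in S) = (f x != 0).
  by rewrite mem_undup; apply/idP/idP => h; [have : [set x | f x != 0] x by rewrite s0E
    | have : [set` s0] x by rewrite -s0E].
have p0 : p != 0 by rewrite pE gt_eqF// mulr_gt0.
have -> : \sum_(x \in [set: lattice d]) weight beta w x * `|f x| `^ p =
    \sum_(x <- S) weight beta w x * `|f x| `^ p.
  rewrite [RHS]fsbig_seq//; apply/esym.
  apply: (fsbig_widen [set` S] setT) => // x [_ /negP] /=.
  by rewrite Sf negbK => /eqP ->; rewrite normr0 powR0// mulr0.
have D0 : 0 <= 2 * dirichlet w f f.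
  have fS x : f x != 0 -> x \in S by rewrite Sf.
  by have := energy_le_dirichlet w_cond fS (erefl : uniq [::]); rewrite big_nil.
have main := weighted_sobolev_seq hd w_cond max_fin (erefl q) qb uS Sf.
rewrite -/K -pE in main.
have -> : 2 / p = q^-1 by rewrite pE; field; rewrite gt_eqF.
have K0 : 0 <= K.
  rewrite divr_ge0 ?powR_ge0// subr_ge0 -opprB powRN invf_le1 ?powR_gt0//.
  rewrite -[leLHS](powRr0 2) ler_powR ?subr_ge0 ?(ltW qb)//; lra.
have -> : 2 * K `^ q^-1 * dirichlet w f f = (K * (2 * dirichlet w f f) `^ q) `^ q^-1.
  by rewrite powRM ?powR_ge0// -powRrM divff ?gt_eqF// powRr1//; ring.
apply: ge0_ler_powR main; rewrite ?nnegrE ?invr_ge0 ?(ltW q0)//.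
  by apply: sumr_ge0 => x _; rewrite mulr_ge0 ?powR_ge0.
by rewrite mulr_ge0 ?powR_ge0.
Qed.
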